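(* Let $\mathcal{I}$ be a non-pathological $\mathbf{\Sigma^0_2}$ ideal on $\omega$. The following are equivalent: (a) $\mathcal{I}$ is Egorov; (b) $\mathcal{I}$ is countably generated; (c) $\mathcal{I}$ is isomorphic to $\mathrm{Fin}$, to $\mathrm{Fin}\oplus\mathcal{P}(\omega)$ or to $\mathrm{Fin}\otimes\{\emptyset\}$.
   Context: An ideal on a countable set $X$ is a family $\mathcal{I}\subseteq\mathcal{P}(X)$ closed under finite unions and subsets, containing all finite subsets of $X$, with $X\notin\mathcal{I}$. Subsets of $X$ are identified with their characteristic functions, so $\mathcal{P}(X)\cong 2^X$ carries the product (Cantor) topology and descriptive complexity ($\mathbf{\Sigma^0_2}$ etc.) of ideals refers to this topology. $\mathcal{I}$ is generated by $\mathcal{A}\subseteq\mathcal{P}(X)$ if $\mathcal{A}\subseteq\mathcal{I}$ and every $B\in\mathcal{I}$ is contained in a union of finitely many members of $\mathcal{A}$; countably generated means generated by a countable family. Ideals $\mathcal{I}$ on $X$ and $\mathcal{J}$ on $Y$ are isomorphic if there is a bijection $f:Y\to X$ with $A\in\mathcal{I}\iff f^{-1}[A]\in\mathcal{J}$ for all $A\subseteq X$. A submeasure is $\phi:\mathcal{P}(\omega)\to[0,\infty]$ with $\phi(\emptyset)=0$, $\phi(\{n\})<\infty$ for all $n$, and $\phi(A)\le\phi(A\cup B)\le\phi(A)+\phi(B)$; it is lower semicontinuous if $\phi(A)=\lim_n\phi(A\cap n)$ for all $A$; it is non-pathological if $\phi(A)=\sup\{\mu(A):\mu$ a measure on $\omega$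 with $\mu\le\phi\}$ for all $A$. $\mathrm{Fin}(\phi)=\{A\subseteq\omega:\phi(A)<\infty\}$. Every $\mathbf{\Sigma^0_2}$ ideal on $\omega$ is of the form $\mathrm{Fin}(\phi)$ for a lower semicontinuous submeasure $\phi$; a $\mathbf{\Sigma^0_2}$ ideal is non-pathological if it equals $\mathrm{Fin}(\phi)$ for some non-pathological (lower semicontinuous) submeasure $\phi$. $\mathrm{Fin}$ is the ideal of finite subsets of $\omega$; $\mathrm{Fin}\oplus\mathcal{P}(\omega)=\{M\subseteq\{0,1\}\times\omega: \{n:(0,n)\in M\}\in\mathrm{Fin}\}$; $\mathrm{Fin}\otimes\{\emptyset\}=\{M\subseteq\omega\times\omega:\{i: \exists j\,(i,j)\in M\}\in\mathrm{Fin}\}$. For an ideal $\mathcal{I}$ on a countable set $S$ and functions $f_s,f:Y\to\mathbb{R}$ ($s\in S$): $(f_s)$ is $\mathcal{I}$-pointwise convergent to $f$ if for every $y\in Y$ and $\varepsilon>0$, $\{s:|f_s(y)-f(y)|\ge\varepsilon\}\in\mathcal{I}$; it is $\mathcal{I}$-uniformly convergent to $f$ if for every $\varepsilon>0$, $\{s:\exists y\in Y\ |f_s(y)-f(y)|\ge\varepsilon\}\in\mathcal{I}$. $\mathcal{I}$ is Egorov if for every family $(f_s)_{s\in S}$ of Lebesgue measurable functions $[0,1]\to\mathbb{R}$ that is $\mathcal{I}$-pointwise convergent to a Lebesgue measurable $f:[0,1]\to\mathbb{R}$ and every $\eta>0$ there is a Lebesgue measurable $M\subseteq[0,1]$ with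 $\lambda([0,1]\setminus M)<\eta$ ($\lambda$ Lebesgue measure) such that $(f_s\restriction M)_{s\in S}$ is $\mathcal{I}$-uniformly convergent to $f\restriction M$. *)

(* Defs.v *)
From HB Require Import structures.
From mathcomp Require Import all_boot all_order all_algebra.
From mathcomp Require Import all_classical all_reals all_analysis.
From mathcomp Require Import borel_hierarchy.

Set Implicit Arguments.
Unset Strict Implicit.
Unset Printing Implicit Defensive.

Import Order.TTheory GRing.Theory Num.Theory.
Import numFieldNormedType.Exports.

Local Open Scope classical_set_scope.
Local Open Scope ring_scope.

Record is_ideal (X : countType) (I : set (set X)) : Prop := IsIdeal {
  ideal_sub : forall A B : set X, A `<=` B -> I B -> I A;
  ideal_setU : forall A B : set X, I A -> I B -> I (A `|` B);
  ideal_finite : forall A : set X, finite_set A -> I A;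
  ideal_proper : ~ I [set: X] }.

Definition generated_by (X : countType) (G I : set (set X)) : Prop :=
  G `<=` I /\
  forall B, I B -> exists F : set (set X),
    [/\ finite_set F, F `<=` G & B `<=` \bigcup_(C in F) C].

Definition countably_generated (X : countType) (I : set (set X)) : Prop :=
  exists2 G : set (set X), countable G & generated_by G I.

Definition ideal_isomorphic (X Y : countType) (I : set (set X))
    (J : set (set Y)) : Prop :=
  exists2 f : Y -> X, bijective f & forall A : set X, I A <-> J (f @^-1` A).

(* F_sigma in the Cantor space, a point of which is the characteristic function
   of a subset of nat. *)
Definition Sigma02 (I : set (set nat)) : Prop :=
  Fsigma [set c : cantor_space | I [set n | c n]].

Definition Fin : set (set nat) := [set A | finite_set A].

(* The set {0, 1} is represented by bool, with 0 = false. *)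
Definition Fin_oplus_P : set (set (bool * nat)) :=
  [set M | Fin [set n | M (false, n)]].

Definition Fin_otimes_empty : set (set (nat * nat)) :=
  [set M | Fin [set i | exists j, M (i, j)]].

Section submeasure.
Variable R : realType.
Implicit Type phi : set nat -> \bar R.
Local Open Scope ereal_scope.

Record is_submeasure phi : Prop := IsSubmeasure {
  submeasure_ge0 : forall A, 0 <= phi A;
  submeasure0 : phi set0 = 0;
  submeasure1_lty : forall n : nat, phi [set n] < +oo;
  submeasure_leU : forall A B, phi A <= phi (A `|` B);
  submeasureU_le : forall A B, phi (A `|` B) <= phi A + phi B }.

Definition submeasure_lsc phi : Prop :=
  forall A, phi (A `&` `I_n) @[n --> \oo] --> phi A.

(* Every subset of the library's measurableType nat is measurable. *)
Definition nonpathological_submeasure phi : Prop :=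
  forall A, phi A = ereal_sup
    [set mu A | mu in [set mu : {measure set nat -> \bar R} |
                        forall B, mu B <= phi B]].

Definition Fin_of phi : set (set nat) := [set A | phi A < +oo].

Definition nonpathological_ideal (I : set (set nat)) : Prop :=
  exists phi, [/\ is_submeasure phi, submeasure_lsc phi,
    nonpathological_submeasure phi & I = Fin_of phi].

End submeasure.

Section ideal_convergence.
Variables (R : realType) (S : countType) (Y : Type).

(* The functions are only considered on the subset D of Y. *)
Definition ideal_pointwise_cvg (I : set (set S)) (D : set Y)
    (f_ : S -> Y -> R) (f : Y -> R) : Prop :=
  forall y, D y -> forall e : R, 0 < e -> I [set s | e <= `|f_ s y - f y|].

Definition ideal_uniform_cvg (I : set (set S)) (D : set Y)
    (f_ : S -> Y -> R) (f : Y -> R) : Prop :=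
  forall e : R, 0 < e -> I [set s | exists2 y, D y & e <= `|f_ s y - f y|].

End ideal_convergence.

Section lebesgue_measurability.
Variable R : realType.

(* R equipped with the Caratheodory sigma-algebra, that is with the Lebesgue
   (not just the Borel) measurable sets; the domain of
   completed_lebesgue_measure. *)
Definition lebesgueTypeR := caratheodory_type (@wlength R idfun)^*%mu.

Definition lebesgue_measurable (A : set R) : Prop :=
  measurable (A : set lebesgueTypeR).

(* The target R has its Borel sigma-algebra. *)
Definition lebesgue_measurable_fun (D : set R) (f : R -> R) : Prop :=
  measurable_fun (D : set lebesgueTypeR) (f : lebesgueTypeR -> R).

End lebesgue_measurability.

Definition Egorov (R : realType) (S : countType) (I : set (set S)) : Prop :=
  forall (f_ : S -> R -> R) (f : R -> R),
    (forall s, lebesgue_measurable_fun `[0, 1] (f_ s)) ->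
    lebesgue_measurable_fun `[0, 1] f ->
    ideal_pointwise_cvg I `[0, 1] f_ f ->
  forall eta : R, 0 < eta ->
  exists M : set R,
    [/\ M `<=` `[0, 1], lebesgue_measurable M,
        (completed_lebesgue_measure (`[0%R, 1%R] `\` M) < eta%:E)%E &
        ideal_uniform_cvg I M f_ f].

(* Main.v *)
Require Import Defs.
From mathcomp Require Import all_boot all_order all_algebra.
From mathcomp Require Import all_classical all_reals all_analysis.
From mathcomp Require Import measurable_realfun lra.

Set Implicit Arguments.
Unset Strict Implicit.
Unset Printing Implicit Defensive.

Import Order.TTheory GRing.Theory Num.Theory.
Import numFieldNormedType.Exports.

Local Open Scope classical_set_scope.
Local Open Scope ring_scope.

(** A countably generated ideal has an increasing cofinal sequence [A n].  If
    all the differences [A m \ A n] are finite for some [n], the ideal is [Fin]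
    or [Fin (+) P(omega)]; otherwise one may assume that all the
    [A n.+1 \ A n] are infinite, and they are the columns of [Fin (x) {empty}].
    Such an ideal is Egorov by the usual proof of Egorov's theorem, the tails
    being the complements of the [A n].

    Conversely, let [I = Fin(phi)] not be countably generated.  Some sublevel set
    of [phi] contains a nonempty family [K] such that, for [x] in [K], the union
    of the members of [K] agreeing with [x] below [n] has infinite [phi].
    Nonpathology gives finitely supported weights [w <= phi] of large total mass
    on that union; picking a point [s] with probability proportional to [w s],
    and then a member of [K] through [s] agreeing with [x] below [n], gives a
    random member of [K] such that, on any event of probability greater than
    1/2, the union of its values has large [phi].  Iterating on longer and longer
    initial segments yields in the limit a map [X] from [0, 1] to subsets of
    omega with [phi (X y)] bounded, while the union of the [X y], [y] in [M], has
    infinite [phi] as soon as [M] has measure greater than 1/2.  The indicator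
    functions of the sets [{y | s in X y}] then contradict Egorov's property. *)

(** * Countably generated ideals and their classification up to isomorphism *)

Lemma finite_set_bounded (A : set nat) :
  finite_set A -> exists n : nat, A `<=` `I_n.
Proof.
move=> /finite_seqP[s ->]; exists (\max_(i <- s) i).+1 => i /= si.
by rewrite ltnS; exact: leq_bigmax_seq.
Qed.

(** Unlike countable generation, this applies to a mere piece [C] of the ideal, and no finite unions
    are involved. *)
Definition countably_dominated (X : countType) (I C : set (set X)) : Prop :=
  exists G : nat -> set X,
    (forall i, I (G i)) /\ forall A, C A -> exists i, A `<=` G i.

Lemma countably_dominated_bigcup (X : countType) (T : countType)
    (I : set (set X)) (C : T -> set (set X)) :
  I set0 -> (forall t, countably_dominated I (C t)) ->
  countably_dominated I (\bigcup_t C t).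
Proof.
move=> I0 /choice[G GP].
pose H (n : nat) :=
  if unpickle n is Some (t, i) then G t i else set0 : set X.
exists H; split=> [n|A [t _ CtA]].
  by rewrite /H; case: unpickle => // -[t i]; exact: (GP t).1.
have [i Ai] := (GP t).2 _ CtA.
by exists (pickle (t, i)); rewrite /H pickleK.
Qed.

Lemma countably_dominated_generated (X : countType) (I : set (set X)) :
  countably_dominated I I -> countably_generated I.
Proof.
move=> [G [IG domG]]; exists (range G).
  by apply: card_image_le.
split=> [_ [i _ <-] //|B /domG[i Bi]].
exists [set G i]; split=> //; first by move=> _ ->; exists i.
by rewrite bigcup_set1.
Qed.

Lemma ideal_bigcup_lt (X : countType) (I : set (set X)) (G : nat -> set X) n :
  is_ideal I -> (forall i, I (G i)) -> I (\bigcup_(i in `I_n) G i).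
Proof.
move=> hI IG; elim: n => [|n IHn].
  by rewrite II0 bigcup_set0; exact: (ideal_finite hI).
by rewrite IIS bigcup_setU bigcup_set1; exact: (ideal_setU hI).
Qed.

Lemma countably_generated_exhaustion (X : countType) (I : set (set X)) :
  is_ideal I -> countably_generated I ->
  exists A : nat -> set X,
    [/\ forall n, I (A n), forall m n, (m <= n)%N -> A m `<=` A n &
        forall B, I B -> exists n, B `<=` A n].
Proof.
move=> hI [G /countable_injP[c cinj] [GI Gcov]].
have I0 : I set0 by exact: (ideal_finite hI).
(* [e n] is the generator of code [n]; an [n] that codes no generator gets the empty set. *)
have /choice[e eP] (n : nat) : exists D, I D /\ forall C, G C -> c C = n -> C `<=` D.
  have [[C [GC <-]]|noC] := pselect (exists C, G C /\ c C = n).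
    exists C; split; first exact: GI.
    by move=> C' GC' eqc; rewrite (cinj C' C) ?inE.
  by exists set0; split=> // C GC cn; case: noC; exists C.
exists (fun n => \bigcup_(i in `I_n) e i); split.
- by move=> n; apply: ideal_bigcup_lt => // i; exact: (eP i).1.
- move=> m n mn; apply: bigcup_subset => i /= im; exact: leq_trans im mn.
move=> B /Gcov[F [finF FG BF]].
have [n cFn] : exists n : nat, [set c C | C in F] `<=` `I_n.
  by apply: finite_set_bounded; exact: finite_image.
exists n => x /BF[C FC Cx]; exists (c C); first by apply: cFn; exists C.
exact: ((eP (c C)).2 C (FG _ FC) erefl).
Qed.

Lemma countably_generated_isomorphic (Y : countType) (I : set (set nat))
    (J : set (set Y)) :
  ideal_isomorphic I J -> countably_dominated J J -> countably_generated I.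
Proof.
move=> [f [g fK gK] IJ] [G [JG Gcov]].
apply: countably_dominated_generated; exists (fun i => g @^-1` G i); split.
  move=> i; rewrite IJ.
  by rewrite -comp_preimage; congr J: (JG i); apply/seteqP; split=> x /=; rewrite fK.
move=> A /IJ/Gcov[i AG]; exists i => x Ax /=.
by apply: AG => /=; rewrite gK.
Qed.

Lemma infinite_nat_bij (A : set nat) :
  infinite_set A -> exists f : nat -> nat, set_bij [set: nat] A f.
Proof.
move=> infA; have /card_esym/pcard_eqP[g] := eq_card_nat (countableP A) infA.
by exists g; exact: bij.
Qed.

Lemma Fin_dominated : countably_dominated Fin Fin.
Proof.
exists (fun n => `I_n); split=> [n|A /finite_set_bounded //].
exact: finite_II.
Qed.

Lemma Fin_oplus_P_dominated : countably_dominated Fin_oplus_P Fin_oplus_P.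
Proof.
exists (fun n => [set p : bool * nat | p.1 \/ (p.2 < n)%N]); split=> [n|M].
  by apply: sub_finite_set (finite_II n) => i [].
by move=> /finite_set_bounded[n Mn]; exists n => -[[] i] Mi; [left|right; exact: Mn].
Qed.

Lemma Fin_otimes_empty_dominated :
  countably_dominated Fin_otimes_empty Fin_otimes_empty.
Proof.
exists (fun n => [set p : nat * nat | (p.1 < n)%N]); split=> [n|M].
  by apply: sub_finite_set (finite_II n) => i [].
by move=> /finite_set_bounded[n Mn]; exists n => -[i j] Mij; apply: Mn; exists j.
Qed.

(** Membership in [I] amounts to finiteness outside [A n]. If [A n] is infinite it becomes the copy
    of omega carrying the full power set; its complement is infinite because [I] is proper, and
    carries [Fin]. *)
Lemma isomorphic_Fin_or_oplus (I : set (set nat)) (A : nat -> set nat) n :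
  is_ideal I -> (forall n, I (A n)) ->
  (forall B, I B -> exists n, B `<=` A n) ->
  (forall m, finite_set (A m `\` A n)) ->
  ideal_isomorphic I Fin \/ ideal_isomorphic I Fin_oplus_P.
Proof.
move=> hI IA cofA finA.
have IE B : I B <-> finite_set (B `\` A n).
  split=> [/cofA[m Bm]|finB].
    by apply: sub_finite_set (finA m); exact: setSD.
  apply: (ideal_sub hI (B := (B `\` A n) `|` A n)).
    by move=> x Bx; have [|] := pselect (A n x); [right|left].
  by apply: (ideal_setU hI) => //; exact: (ideal_finite hI).
have [fA|iA] := pselect (finite_set (A n)).
  left; exists id => [|B]; first by exists id.
  rewrite preimage_id IE; split=> [fB|fB]; last first.
    by apply: sub_finite_set fB => x [].
  apply: (@sub_finite_set _ _ ((B `\` A n) `|` A n)); last by rewrite finite_setU.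
  by move=> x Bx; have [|] := pselect (A n x); [right|left].
right; have iC : infinite_set (~` A n).
  by move=> fC; apply: (ideal_proper hI); apply/IE; rewrite setTD.
have [g [gA ginj gsurj]] := infinite_nat_bij iA.
have [h [hA hinj hsurj]] := infinite_nat_bij iC.
exists (fun p => if p.1 then g p.2 else h p.2).
  rewrite -setTT_bijective; split=> //.
    move=> [[] i] [[] j] _ _ /= e.
    - by rewrite (ginj i j) ?inE.
    - by case: (hA j) => //; rewrite -e; exact: gA.
    - by case: (hA i) => //; rewrite e; exact: gA.
    - by rewrite (hinj i j) ?inE.
  move=> k _; have [/gsurj[i _ <-]|/hsurj[i _ <-]] := pselect (A n k).
    by exists (true, i).
  by exists (false, i).
move=> B; rewrite IE; split=> [finB|].
  apply: (@sub_finite_set _ _ (h @^-1` (B `\` A n))).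
    by move=> i /= Bi; split=> //; exact: hA.
  by apply: finite_preimage finB => i j _ _; apply: hinj; rewrite inE.
move=> /(finite_image h); apply: sub_finite_set => k [Bk /hsurj[i _ hik]].
by exists i => //=; rewrite hik.
Qed.

(** The differences [A n.+1 \ A n] partition omega, since [A 0] is empty and singletons lie in [I].
    Enumerating each of them gives the columns. *)
Lemma isomorphic_Fin_otimes (I : set (set nat)) (A : nat -> set nat) :
  is_ideal I -> (forall n, I (A n)) ->
  (forall m n, (m <= n)%N -> A m `<=` A n) -> A 0%N = set0 ->
  (forall B, I B -> exists n, B `<=` A n) ->
  (forall n, infinite_set (A n.+1 `\` A n)) ->
  ideal_isomorphic I Fin_otimes_empty.
Proof.
move=> hI IA mono A0 cofA infA.
have /choice[g gP] := fun n => infinite_nat_bij (infA n).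
have block k : exists n, (A n.+1 `\` A n) k.
  have [m km] := cofA [set k] (ideal_finite hI (finite_set1 k)).
  have exm : exists m, `[<A m k>] by exists m; apply/asboolP; exact: km.
  case: (ex_minnP exm) => -[|n] /asboolP Ank minA; first by rewrite A0 in Ank.
  by exists n; split=> // /asboolP/minA; rewrite ltnn.
have uniq_block i j k : (A i.+1 `\` A i) k -> (A j.+1 `\` A j) k -> i = j.
  move=> [Ai nAi] [Aj nAj]; apply/eqP; rewrite eqn_leq; apply/andP.
  split; rewrite leqNgt; apply/negP => ij.
  - by apply: nAi; exact: mono Aj.
  - by apply: nAj; exact: mono Ai.
exists (fun p => g p.1 p.2).
  rewrite -setTT_bijective; split=> //.
    move=> [i j] [i' j'] _ _ /= e.
    have ii' : i = i'.
      have [gi _ _] := gP i; have [gi' _ _] := gP i'.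
      by apply: (@uniq_block _ _ (g i j)); [exact: gi|rewrite e; exact: gi'].
    move: e; rewrite -ii' => e; have [_ ginj _] := gP i.
    by rewrite (ginj j j') ?inE.
  move=> k _; have [n nk] := block k.
  by have [_ _ /(_ _ nk)[j _ gk]] := gP n; exists (n, j).
move=> B; split=> [/cofA[n Bn]|/finite_set_bounded[n Bn]].
  apply: (@sub_finite_set _ _ `I_n); last exact: finite_II.
  move=> i /= [j /Bn Ang]; rewrite ltnNge; apply/negP => ni.
  have [gi _ _] := gP i; have [//|_] := gi j; apply; exact: mono Ang.
apply: ideal_sub (IA n) => // k Bk; have [i ik] := block k.
have [_ _ /(_ _ ik)[j _ gk]] := gP i.
apply: (mono i.+1); last by case: ik.
by apply: (Bn i); exists j; rewrite /= gk.
Qed.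

Lemma countably_generated_classification (I : set (set nat)) :
  is_ideal I ->
  countably_generated I <->
  ideal_isomorphic I Fin \/ ideal_isomorphic I Fin_oplus_P \/
  ideal_isomorphic I Fin_otimes_empty.
Proof.
move=> hI; split; last first.
  move=> [|[|]] /countably_generated_isomorphic; apply.
  - exact: Fin_dominated.
  - exact: Fin_oplus_P_dominated.
  - exact: Fin_otimes_empty_dominated.
move=> /(countably_generated_exhaustion hI)[A [IA mono cofA]].
have [[n finA]|] := pselect (exists n, forall m, finite_set (A m `\` A n)).
  by have [] := isomorphic_Fin_or_oplus hI IA cofA finA; [left|right; left].
move=> /forallNP noA.
have /choice[s sP] n : exists m, infinite_set (A m `\` A n).
  by have /existsNP := noA n.
right; right.
have slt n : (n < s n)%N.
  rewrite ltnNge; apply/negP => /mono; rewrite -setD_eq0 => An0.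
  by apply: (sP n); rewrite An0.
(* Along the iterates of [s] consecutive differences are infinite; [A'] puts the empty set in front
   of them. *)
pose t k := iter k s (s 0%N).
pose A' k := if k is k'.+1 then A (t k') else set0.
have tk k : (k <= t k)%N.
  by elim: k => // k IHk; rewrite (leq_ltn_trans IHk)//=; exact: slt.
apply: (@isomorphic_Fin_otimes I A') => //.
- by case=> [|k]; [exact: (ideal_finite hI)|exact: IA].
- case=> [|m] n mn; first exact: sub0set.
  case: n mn => [//|n]; rewrite ltnS => mn; apply: mono; move: mn.
  move=> /subnK <-; elim: (n - m)%N => //= d /leq_trans; apply.
  by rewrite ltnW// slt.
- move=> B /cofA[n Bn]; exists n.+1; exact: subset_trans Bn (mono _ _ (tk n)).
- case=> [|n] /=; last exact: sP.
  rewrite setD0 => fin; apply: (sP 0%N); apply: sub_finite_set fin.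
  exact: subDsetl.
Qed.

(** * Egorov's theorem along an increasing sequence of index sets *)

Lemma nonincreasing_measure_lt d (T : measurableType d) (R : realType)
    (mu : {measure set T -> \bar R}) (E : nat -> set T) (e : R) :
  (mu (E 0%N) < +oo)%E -> (forall n, measurable (E n)) ->
  (forall m n, (m <= n)%N -> E n `<=` E m) -> \bigcap_n E n = set0 ->
  0 < e -> exists n, (mu (E n) < e%:E)%E.
Proof.
move=> E0 mE decE capE e0.
have : (mu \o E) x @[x --> \oo] --> mu (\bigcap_n E n).
  apply: nonincreasing_cvg_mu => //; first by rewrite capE.
  by move=> m n mn; apply/subsetPset; exact: decE.
rewrite capE measure0 => /(_ [set x | (x < e%:E)%E])[|n _ /(_ n (leqnn n)) lt_e].
  by apply: (open_ereal_lt' (x := 0%E)); rewrite lte_fin.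
by exists n.
Qed.

Lemma almost_uniform_exhaustion d (T : measurableType d) (R : realType)
    (mu : {measure set T -> \bar R}) (S : countType) (A : nat -> set S)
    (D : set T) (f_ : S -> T -> R) (f : T -> R) (eta : R) :
  measurable D -> (mu D < +oo)%E ->
  (forall m n, (m <= n)%N -> A m `<=` A n) ->
  (forall s, measurable_fun D (f_ s)) -> measurable_fun D f ->
  (forall y, D y -> forall e : R, 0 < e ->
     exists n, [set s | e <= `|f_ s y - f y|] `<=` A n) ->
  0 < eta ->
  exists M, [/\ M `<=` D, measurable M, (mu (D `\` M) < eta%:E)%E &
    forall e : R, 0 < e ->
      exists n, [set s | exists2 y, M y & e <= `|f_ s y - f y|] `<=` A n].
Proof.
move=> mD Doo mono mf_ mf cvg eta0.
(* The points with an error of at least [1 / k.+1] at some index outside [A n]; for fixed [k] these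
   sets decrease to the empty set. *)
pose E k n := D `&` \bigcup_(s in ~` A n) [set y | k.+1%:R^-1 <= `|f_ s y - f y|].
have mE k n : measurable (E k n).
  rewrite /E setI_bigcupr bigcup_mkcond; apply: countable_bigcupT_measurable.
    exact: countableP.
  move=> s; case: ifP => // _.
  have mg : measurable_fun D (fun y => `|f_ s y - f y|).
    by apply: measurableT_comp => //; exact: measurable_funB.
  rewrite (_ : [set y | _] = (fun y => `|f_ s y - f y|) @^-1` `[k.+1%:R^-1, +oo[).
    by apply: mg => //; exact: measurable_itv.
  by apply/seteqP; split=> y /=; rewrite in_itv/= andbT.
(* These bounds sum to [eta / 2]; the extra half makes the final estimate strict. *)
have EP k : exists n, (mu (E k n) < (eta / 2 / (2 ^ k.+1)%:R)%:E)%E.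
  apply: nonincreasing_measure_lt => //.
  - by apply: le_lt_trans Doo; apply: le_measure; rewrite ?inE// => y [].
  - move=> m n mn y [Dy [s nAs fs]]; split=> //; exists s => //.
    by move=> /= /(mono _ _ mn).
  - apply/seteqP; split=> // y capy; have [Dy _] := capy 0%N I.
    have [|n fA] := cvg y Dy k.+1%:R^-1; first by rewrite invr_gt0.
    by have [_ [s nAs /fA]] := capy n I.
  - by rewrite !divr_gt0// ltr0n expn_gt0.
have /choice[b bP] := EP.
exists (D `\` \bigcup_k E k (b k)); split.
- by move=> y [].
- by apply: measurableD => //; exact: bigcup_measurable.
- apply: (@le_lt_trans _ _ (eta / 2)%:E); last first.
    by rewrite lte_fin ltr_pdivrMr// ltr_pMr// ltr1n.
  apply: le_trans (epsilon_trick0 xpredT _); last by rewrite divr_ge0// ltW.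
  apply: (@le_trans _ _ (\sum_(0 <= k <oo) mu (E k (b k)))%E).
    apply: measure_sigma_subadditive => //.
    + apply: measurableD => //; apply: measurableD => //.
      exact: bigcup_measurable.
    + by rewrite setDD => y [].
  by apply: lee_nneseries => // k _; exact/ltW.
move=> e e0; have [N _ /(_ N (leqnn N)) /= Ne] := near_infty_natSinv_lt (PosNum e0).
exists (b N) => s [y [Dy nE] fs]; apply: contrapT => nAs; apply: nE.
exists N => //; split=> //; exists s => //=; exact: le_trans (ltW Ne) fs.
Qed.

(** * Initial segments, the kernel of a sublevel set, and weights below a submeasure *)

Definition trace n (x : set nat) : {ffun 'I_n -> bool} :=
  [ffun i : 'I_n => `[< x i >]].

Lemma traceP n (x y : set nat) :
  trace n x = trace n y <-> forall i, (i < n)%N -> (x i <-> y i).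
Proof.
split=> [/ffunP xy i ilt|xy]; last first.
  by apply/ffunP => i; rewrite !ffunE; apply: asbool_equiv_eq; exact: xy.
have := xy (Ordinal ilt); rewrite !ffunE /= => exy.
by split=> /asboolP; [rewrite exy|rewrite -exy] => /asboolP.
Qed.

Section submeasure_lemmas.
Variables (R : realType) (phi : set nat -> \bar R).
Hypothesis phi_sub : is_submeasure phi.

Lemma submeasure_le (A B : set nat) : A `<=` B -> (phi A <= phi B)%E.
Proof. by move=> /setUidPr <-; exact: submeasure_leU. Qed.

(* [K] is a Cantor-Bendixson kernel of a sublevel set of [phi]: remove the basic
   clopen sets whose trace on it is covered by countably many sets in the ideal. *)
Lemma submeasure_kernel : ~ countably_generated (Fin_of phi) ->
  exists (m : nat) (K : set (set nat)),
    [/\ K !=set0, forall x, K x -> (phi x <= m%:R%:E)%E &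
        forall x n, K x ->
          phi (\bigcup_(y in [set y | K y /\ trace n y = trace n x]) y) = +oo%E].
Proof.
move=> ncg; pose I := Fin_of phi.
have I0 : I set0 by rewrite /I /Fin_of /= submeasure0.
(* [T] indexes the basic clopen sets of the Cantor space, each given by a length and an initial
   segment. *)
pose T : countType := {n & {ffun 'I_n -> bool}}.
pose cell (m : nat) (t : T) :=
  [set A | (phi A <= m%:R%:E)%E /\ trace (tag t) A = tagged t].
pose small m t := countably_dominated I (cell m t).
pose smallcell m t := if `[< small m t >] then cell m t else set0.
have domsmall m t : countably_dominated I (smallcell m t).
  rewrite /smallcell; case: asboolP => // _.
  by exists (fun=> set0).
pose K m := [set A | (phi A <= m%:R%:E)%E /\
  forall n, ~ small m (Tagged (fun n => {ffun 'I_n -> bool}) (trace n A))].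
have [[m [x0 Kx0]]|noK] := pselect (exists m, K m !=set0); last first.
  (* If every [K m] were empty, each member of the ideal would lie in one of countably many small
     cells, so the ideal would be countably dominated. *)
  exfalso; apply/ncg/countably_dominated_generated.
  have [] := @countably_dominated_bigcup _ _ I
    (fun u : nat * T => smallcell u.1 u.2) I0 (fun u => domsmall u.1 u.2).
  move=> G [IG domG]; exists G; split=> // A IA; apply: domG.
  have [m Am] : exists m : nat, (phi A <= m%:R%:E)%E.
    exists (Num.truncn (fine (phi A))).+1.
    have Afin : phi A \is a fin_num by rewrite ge0_fin_numE// (submeasure_ge0 phi_sub).
    rewrite -(fineK Afin) lee_fin ltW// truncnS_gt//.
  have [n sn] : exists n, small m (Tagged (fun n => {ffun 'I_n -> bool}) (trace n A)).
    apply: contrapT => /forallNP nsm; apply: noK; exists m, A; split=> //.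
  exists (m, Tagged (fun n => {ffun 'I_n -> bool}) (trace n A)) => //=.
  by rewrite /smallcell asboolT.
exists m, (K m); split=> [|x [] //|x n [phix nsmall]]; first by exists x0.
(* If [D] were in the ideal, it would dominate the members of [K m] in the cell of [x] (index
   [None]), and the small cells would dominate the others (index [Some t]): the cell would be
   small. *)
set D := \bigcup_(y in _) y; apply: contrapT => /eqP; rewrite -ltey => ID.
apply: (nsmall n).
have [] := @countably_dominated_bigcup _ (option T) I
  (fun u => if u is Some t then smallcell m t else [set A | A `<=` D]) I0.
  by case=> [t|] //; exists (fun=> D); split=> // A AD; exists 0%N.
move=> G [IG domG]; exists G; split=> // A [phiA Ax]; apply: domG.
have [KA|] := pselect (K m A).
  by exists None => // s As; exists A.
move=> /not_andP[//|/existsNP[n' /contrapT sn']].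
exists (Some (Tagged (fun n => {ffun 'I_n -> bool}) (trace n' A))) => //=.
by rewrite /smallcell asboolT.
Qed.

Lemma measure_setI_II (mu : {measure set nat -> \bar R}) (B : set nat) q :
  mu (B `&` `I_q) = (\sum_(s < q) mu (B `&` [set s : nat]))%E.
Proof.
elim: q => [|q IHq]; first by rewrite II0 setI0 measure0 big_ord0.
rewrite big_ord_recr/= -IHq IIS setIUr; apply: measureU => //.
by apply/seteqP; split=> // i [[_ /= iq] [_ /= iE]]; rewrite iE ltnn in iq.
Qed.

(** Some measure below [phi] gives [D] mass above [N]. The weights are its point masses on [D],
    finite because [phi] is finite on singletons; continuity from below lets finitely many of them
    exceed [N]. *)
Lemma nonpathological_weights (D : set nat) (N : R) :
  nonpathological_submeasure phi -> phi D = +oo%E ->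
  exists (q : nat) (w : nat -> R),
    [/\ forall s, 0 <= w s, forall s, ~ D s -> w s = 0,
        N < \sum_(s < q) w s &
        forall S : set nat, ((\sum_(s < q | `[< S s >]) w s)%:E <= phi S)%E].
Proof.
move=> np Doo.
have : (N%:E < phi D)%E by rewrite Doo ltry.
rewrite np => /ereal_sup_gt[_ [mu /= mule <-] NmuD].
have mufin s : mu (D `&` [set s]) \is a fin_num.
  rewrite ge0_fin_numE// (le_lt_trans (mule _))//.
  apply: le_lt_trans (submeasure1_lty phi_sub s).
  by apply: submeasure_le => i [].
have [q Nq] : exists q, (N%:E < mu (D `&` `I_q))%E.
  have : (mu \o (fun q => D `&` `I_q)) x @[x --> \oo] --> mu (\bigcup_q (D `&` `I_q)).
    apply: nondecreasing_cvg_mu => // i j ij; apply/subsetPset.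
    by apply: setIS => k /= /leq_trans; exact.
  have -> : \bigcup_q (D `&` `I_q) = D.
    by apply/seteqP; split=> [i [q _ []] //|i Di]; exists i.+1 => //; split=> /=.
  move=> /(_ [set x | (N%:E < x)%E])[|q _ /(_ q (leqnn q)) lt_q].
    exact: open_ereal_gt'.
  by exists q.
exists q, (fun s => fine (mu (D `&` [set s]))); split.
- by move=> s; exact: fine_ge0.
- move=> s nDs; rewrite (_ : D `&` _ = set0) ?measure0//.
  by apply/seteqP; split=> // i [Di /= si]; rewrite si in Di.
- rewrite -lte_fin -sumEFin; under eq_bigr do rewrite fineK//.
  by rewrite -measure_setI_II.
move=> S; rewrite -sumEFin; under eq_bigr do rewrite fineK//.
rewrite [leLHS](_ : _ = mu (D `&` S `&` `I_q)).
  by apply: le_trans (mule _) _; apply: submeasure_le => i [[]].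
rewrite measure_setI_II big_mkcond/=; apply: eq_bigr => s _.
case: asboolP => Ss.
  have -> // : D `&` S `&` [set val s] = D `&` [set val s].
  by rewrite -setIA (setIidr (A := S))// => i /= ->.
rewrite (_ : D `&` S `&` _ = set0) ?measure0//.
by apply/seteqP; split=> // i [[_ Si] /= iE]; apply: Ss; rewrite -iE.
Qed.
End submeasure_lemmas.

(** * Random members of the kernel and their limit *)

(* The intermediate value property of atomless measures. *)
Definition divisible d (T : measurableType d) (R : realType)
    (mu : {measure set T -> \bar R}) (D : set T) : Prop :=
  forall E, measurable E -> E `<=` D -> forall t : R, 0 <= t -> (t%:E <= mu E)%E ->
    exists A, [/\ A `<=` E, measurable A & mu A = t%:E].

Section divisible_measure.
Context d (T : measurableType d) (R : realType).
Variables (mu : {measure set T -> \bar R}) (D : set T).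
Hypotheses (mD : measurable D) (Doo : (mu D < +oo)%E) (divD : divisible mu D).

(** [sel] is a random index with unnormalised law [w] on [E], built by cutting off the piece for the
    last index and recursing on the rest. *)
Lemma divisible_split (q : nat) (w : nat -> R) (E : set T) :
  (forall s, 0 <= w s) -> measurable E -> E `<=` D ->
  mu E = (\sum_(s < q.+1) w s)%:E ->
  exists sel : T -> nat,
    (forall y, (sel y < q.+1)%N) /\
    forall s, (s < q.+1)%N ->
      measurable (E `&` sel @^-1` [set s]) /\
      mu (E `&` sel @^-1` [set s]) = (w s)%:E.
Proof.
move=> w0; elim: q E => [|q IHq] E mE ED muE.
  exists (fun=> 0%N); split=> // -[_|//].
  have -> : E `&` (fun=> 0%N) @^-1` [set 0%N] = E.
    by apply/seteqP; split=> y // [].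
  by split=> //; rewrite muE big_ord_recr big_ord0/= add0r.
have [|A [AE mA muA]] := divD mE ED (w0 q.+1).
  rewrite muE lee_fin [leRHS]big_ord_recr/= lerDr.
  exact: sumr_ge0.
have mEA : measurable (E `\` A) by exact: measurableD.
have muEA : mu (E `\` A) = (\sum_(s < q.+1) w s)%:E.
  have -> : mu (E `\` A) = (mu E - mu A)%E.
    rewrite measureD ?(setIidr AE)//.
    by apply: (le_lt_trans _ Doo); apply: le_measure; rewrite ?inE.
  by rewrite muE muA big_ord_recr/= -EFinB addrK.
have [|sel [selq selP]] := IHq _ mEA _ muEA; first by move=> y [/ED].
exists (fun y => if `[< A y >] then q.+1 else sel y); split=> [y|s].
  by case: ifP => // _; rewrite ltnS ltnW.
rewrite ltnS leq_eqVlt => /predU1P[->|sq].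
  rewrite (_ : E `&` _ = A)//; apply/seteqP; split=> y /=.
    move=> [Ey]; case: asboolP => // _ selE.
    by have := selq y; rewrite selE ltnn.
  by move=> Ay; split; [exact: AE|rewrite asboolT].
have -> : E `&` (fun y => if `[< A y >] then q.+1 else sel y) @^-1` [set s] =
    (E `\` A) `&` sel @^-1` [set s]; last exact: (selP s sq).
apply/seteqP; split=> y /=.
  move=> [Ey]; case: asboolP => // _ sE.
  by rewrite -sE ltnn in sq.
by move=> [[Ey nAy] sE]; split=> //; rewrite asboolF.
Qed.

Variables (phi : set nat -> \bar R) (K : set (set nat)).
Hypotheses (phi_sub : is_submeasure phi) (phi_np : nonpathological_submeasure phi).
Hypothesis K_kernel : forall x n, K x ->
  phi (\bigcup_(y in [set y | K y /\ trace n y = trace n x]) y) = +oo%E.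

(** For measurable [E], this is Borel measurability on [E] as a map into the Cantor space, tested on
    subbasic clopen sets. *)
Definition measurable_set_valued (E : set T) (X : T -> set nat) : Prop :=
  forall s, measurable (E `&` [set y | X y s]).

Lemma kernel_cell (E : set T) (x : set nat) n (N : nat) :
  K x -> measurable E -> E `<=` D ->
  exists (q : nat) (X : T -> set nat),
    [/\ forall y, K (X y) /\ trace n (X y) = trace n x, measurable_set_valued E X &
      forall M, measurable M -> M `<=` E -> (mu E < mu M + mu M)%E ->
        (N%:R%:E <= phi ((\bigcup_(y in M) X y) `&` `I_q))%E].
Proof.
move=> Kx mE ED; pose B := \bigcup_(y in [set y | K y /\ trace n y = trace n x]) y.
(* Total weight above [2N] is requested because [M] is only known to fill more than half of [E]. *)
have [q [w [w0 wB Nw wphi]]] := nonpathological_weights phi_sub (N%:R + N%:R)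
   phi_np (K_kernel n Kx).
have muEfin : mu E \is a fin_num.
  by rewrite ge0_fin_numE// (le_lt_trans _ Doo)// le_measure ?inE.
case: q Nw wphi => [|q] Nw wphi.
  by exfalso; move: Nw; rewrite big_ord0 -natrD ltrn0.
set W := \sum_(s < q.+1) w s in Nw.
have W0 : 0 < W by rewrite (le_lt_trans _ Nw)// -natrD.
have [||||sel [selq selP]] := @divisible_split q (fun s => w s * (fine (mu E) / W)) E.
- move=> s; apply: mulr_ge0 => //; apply: divr_ge0; last exact: ltW.
  exact: fine_ge0.
- exact: mE.
- exact: ED.
- rewrite -mulr_suml -/W mulrCA divff ?gt_eqF// mulr1 fineK//.
(* [xs s] is a member of the kernel cell through [s]; outside [B], where the weights vanish, [x]
   serves as default. *)
have /choice[xs xsP] s : exists x', (K x' /\ trace n x' = trace n x) /\ (B s -> x' s).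
  have [[x' Kx' x's]|nBs] := pselect (B s); first by exists x'.
  by exists x; split=> // /nBs.
exists q.+1, (xs \o sel); split=> [y|s|M mM ME].
- exact: (xsP _).1.
- rewrite (_ : _ `&` _ = \bigcup_(t in [set t | (t < q.+1)%N /\ xs t s])
      (E `&` sel @^-1` [set t])).
    by apply: bigcup_measurable => t [/selP[]].
  apply/seteqP; split=> y /=; first by move=> [Ey xss]; exists (sel y).
  by move=> [t [tq xts] [Ey selE]]; rewrite selE.
set S := [set t | exists2 y, M y & sel y = t] => Mbig.
(* The fibres of [sel] over [S] cover [M], so [S] must carry more than half of the weight [W]. *)
have MS : (mu M <= (\sum_(s < q.+1 | `[< S s >]) w s * (fine (mu E) / W))%:E)%E.
  rewrite big_mkcond -sumEFin.
  pose F s := if `[< S s >] then E `&` sel @^-1` [set s] else set0.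
  have mF s : (s < q.+1)%N -> measurable (F s).
    by rewrite /F; case: asboolP => // _ /selP[].
  apply: (@le_trans _ _ (\sum_(s < q.+1) mu (F s))%E).
    apply: content_subadditive => //.
    move=> y My; rewrite -bigcup_mkord; exists (sel y); first exact: selq.
    have Ssel : S (sel y) by exists y.
    by rewrite /F asboolT//; split=> //; exact: ME.
  apply: lee_sum => s _; rewrite /F; case: asboolP => Ss; last by rewrite measure0.
  by rewrite (selP s _).2.
set sigma := \sum_(s < q.+1 | `[< S s >]) w s.
have sigmaN : N%:R <= sigma.
  move: Mbig MS; rewrite -mulr_suml -/sigma -(fineK muEfin).
  have muMfin : mu M \is a fin_num.
    rewrite ge0_fin_numE// (le_lt_trans _ Doo)// le_measure ?inE//.
    exact: subset_trans ED.
  rewrite -(fineK muMfin) -EFinD lte_fin lee_fin.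
  have := fine_ge0 (measure_ge0 mu E); move: (fine (mu E)) (fine (mu M)) => a b a0 ab.
  rewrite mulrA ler_pdivlMr// => bW.
  have a_gt0 : 0 < a.
    rewrite lt_neqAle a0 andbT; apply/eqP => aE.
    move: ab bW; rewrite -aE mulr0 => ab bW.
    have : b <= 0 by rewrite -(pmulr_lle0 _ W0).
    lra.
  have : a * W < (sigma + sigma) * a.
    rewrite mulrDl; apply: (lt_le_trans (y := b * W + b * W)).
      by rewrite -mulrDl ltr_pM2r.
    exact: lerD.
  rewrite mulrC ltr_pM2r// => Wsigma.
  have : N%:R + N%:R < sigma + sigma by exact: lt_trans Wsigma.
  lra.
apply: (@le_trans _ _ sigma%:E); first by rewrite lee_fin.
have -> : sigma = \sum_(s < q.+1 | `[< (S `&` B `&` `I_q.+1) s >]) w s.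
  rewrite /sigma big_mkcond [RHS]big_mkcond/=; apply: eq_bigr => s _.
  have [Bs|/wB ->] := pselect (B s); last by rewrite !if_same.
  by congr (if _ then _ else _); apply: asbool_equiv_eq; split=> [|[[]]].
apply: le_trans (wphi _) _; apply: submeasure_le => // s [[[y My <-] Bs] sq].
by split=> //; exists y => //; exact: (xsP _).2.
Qed.

Lemma measurable_trace (X : T -> set nat) n (v : {ffun 'I_n -> bool}) :
  measurable_set_valued D X -> measurable (D `&` [set y | trace n (X y) = v]).
Proof.
move=> mX; pose F (i : 'I_n) :=
  if v i then D `&` [set y | X y i] else D `\` (D `&` [set y | X y i]).
rewrite (_ : _ `&` _ = D `&` \bigcap_(i in [set: 'I_n]) F i).
  apply: measurableI => //; apply: fin_bigcap_measurable => // i _.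
  by rewrite /F; case: ifP => _; [exact: mX|apply: measurableD => //; exact: mX].
apply/seteqP; split=> y [Dy /= yv]; split=> //.
  move=> i _; rewrite /F -yv ffunE; case: asboolP => Xyi //.
  by split=> // -[].
apply/ffunP => i; rewrite ffunE; have := yv i I; rewrite /F.
case: ifP => _ [_ Xi]; first by rewrite asboolT.
by rewrite asboolF// => Xyi; exact: Xi.
Qed.

Lemma measure_trace (X : T -> set nat) n (M : set T) :
  measurable_set_valued D X -> measurable M -> M `<=` D ->
  mu M = (\sum_(v \in [set: {ffun 'I_n -> bool}])
    mu (M `&` (D `&` [set y | trace n (X y) = v])))%E.
Proof.
move=> mX mM MD; rewrite -measure_fin_bigcup//.
- congr (mu _); apply/seteqP; split=> y; last by move=> [v _ []].
  by move=> My; exists (trace n (X y)) => //; split=> //; split=> //; exact: MD.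
- exact: finite_finset.
- by move=> u v _ _ [y [[_ [_ <-]] [_ [_ <-]]]].
- by move=> v _; apply: measurableI => //; exact: measurable_trace.
Qed.

(** The random choice of [kernel_cell] is made separately on each of the finitely many events fixing
    the trace of [X]. A set filling more than half of [D] fills more than half of one of these
    events. *)
Lemma kernel_refine (X : T -> set nat) n (N : nat) :
  (forall y, D y -> K (X y)) -> measurable_set_valued D X ->
  exists (X' : T -> set nat) (n' : nat),
    [/\ forall y, D y -> K (X' y) /\ trace n (X' y) = trace n (X y),
        measurable_set_valued D X', (n < n')%N &
        forall M, measurable M -> M `<=` D -> (mu D < mu M + mu M)%E ->
          (N%:R%:E <= phi ((\bigcup_(y in M) X' y) `&` `I_n'))%E].
Proof.
move=> KX mX; pose E v := D `&` [set y | trace n (X y) = v].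
have mE v : measurable (E v) by exact: measurable_trace.
have ED v : E v `<=` D by move=> y [].
have /choice[q /choice[g gP]] v : exists q g,
    [/\ forall y, E v y -> K (g y) /\ trace n (g y) = v, measurable_set_valued (E v) g &
        forall M, measurable M -> M `<=` E v -> (mu (E v) < mu M + mu M)%E ->
          (N%:R%:E <= phi ((\bigcup_(y in M) g y) `&` `I_q))%E].
  have [[y0 [Dy0 y0v]]|noy] := pselect (exists y, E v y).
    have [q [g [gK mg gN]]] := kernel_cell n N (KX _ Dy0) (mE v) (ED v).
    by exists q, g; split=> // y _; rewrite -y0v; exact: gK.
  have E0 : E v = set0 by apply/seteqP; split=> y // Ey; case: noy; exists y.
  exists 0%N, (fun=> set0); rewrite E0; split=> // [s|M _].
    by rewrite set0I.
  by rewrite subset0 => ->; rewrite measure0 adde0 ltxx.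
(* The new length exceeds [n] and is at least every truncation bound [q v]. *)
exists (fun y => g (trace n (X y)) y), (maxn n.+1 (\max_v q v)); split.
- by move=> y Dy; have [gK _ _] := gP (trace n (X y)); exact: gK.
- move=> s; rewrite (_ : _ `&` _ =
      \bigcup_v (E v `&` [set y | g v y s])).
    apply: countable_bigcupT_measurable; first exact: countableP.
    by move=> v; have [_ + _] := gP v; exact.
  apply/seteqP; split=> y /=; first by move=> [Dy gy]; exists (trace n (X y)).
  by move=> [v _ [[Dy /= yv]]]; rewrite -yv.
- by rewrite leq_max leqnn.
move=> M mM MD Mbig.
have [v vbig] : exists v, (mu (E v) < mu (M `&` E v) + mu (M `&` E v))%E.
  apply: contrapT => /forallNP small; move: Mbig; apply/negP; rewrite -leNgt.
  rewrite (measure_trace n mX mM MD) -fsbig_split; last exact: finite_finset.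
  rewrite [leRHS](measure_trace n mX mD (@subset_refl _ D)).
  apply: lee_fsum => [|v _]; first exact: finite_finset.
  rewrite (setIidr (ED v)) leNgt; apply/negP; exact: small.
have [_ _ /(_ (M `&` E v))] := gP v.
have mME : measurable (M `&` E v) by exact: measurableI.
move=> /(_ mME (@subIsetr _ _ _) vbig) /le_trans; apply.
apply: submeasure_le => // s [[y [My [Dy yv]]] gs] /= sq; split.
  by exists y => //; rewrite yv.
by rewrite /= (leq_trans sq)// leq_max leq_bigmax orbT.
Qed.

Hypothesis phi_lsc : submeasure_lsc phi.

(** Each stage preserves the initial segment fixed before it, so the stages converge pointwise.
    Lower semicontinuity passes the bound [m] to the limit, while a large union is already witnessed
    on a fixed initial segment and therefore persists. *)
Lemma kernel_limit (m : nat) : K !=set0 ->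
  (forall x, K x -> (phi x <= m%:R%:E)%E) ->
  exists X : T -> set nat,
    [/\ measurable_set_valued D X, forall y, D y -> (phi (X y) <= m%:R%:E)%E &
        forall M, measurable M -> M `<=` D -> (mu D < mu M + mu M)%E ->
          phi (\bigcup_(y in M) X y) = +oo%E].
Proof.
move=> [x0 Kx0] Km.
pose ok (p : (T -> set nat) * nat) :=
  (forall y, D y -> K (p.1 y)) /\ measurable_set_valued D p.1.
pose next (N : nat) (p p' : (T -> set nat) * nat) :=
  [/\ forall y, D y -> trace p.2 (p'.1 y) = trace p.2 (p.1 y), (p.2 < p'.2)%N &
      forall M, measurable M -> M `<=` D -> (mu D < mu M + mu M)%E ->
          (N%:R%:E <= phi ((\bigcup_(y in M) p'.1 y) `&` `I_p'.2))%E].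
have /choice[F FP] (Np : nat * ((T -> set nat) * nat)) :
    exists p', ok Np.2 -> ok p' /\ next Np.1 Np.2 p'.
  have [[KX mX]|nok] := pselect (ok Np.2); last by exists Np.2.
  have [X' [n' [KX' mX' nn' bigX']]] := kernel_refine Np.2.2 Np.1 KX mX.
  exists (X', n') => _; split; first by split=> // y /KX'[].
  by split=> // y /KX'[].
pose u := fix u k := if k is k'.+1 then F (k', u k') else ((fun=> x0), 0%N).
have uok k : ok (u k).
  elim: k => [|k /(FP (k, u k))[]//]; split=> // s /=.
  have [x0s|nx0s] := pselect (x0 s).
    by rewrite (_ : [set _ | _] = setT) ?setIT//; apply/seteqP; split.
  by rewrite (_ : [set _ | _] = set0) ?setI0//; apply/seteqP; split.
have unext k : next k (u k) (u k.+1) by exact: (FP (k, u k) (uok k)).2.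
have ugt k : (k <= (u k).2)%N.
  by elim: k => // k IHk; rewrite (leq_ltn_trans IHk)//; have [_ +] := unext k.
have umono j k : (j <= k)%N -> ((u j).2 <= (u k).2)%N.
  move=> /subnK <-; elim: (k - j)%N => //= i /leq_trans; apply.
  by have [_ /ltnW] := unext (i + j)%N.
have ustable j k y i : D y -> (j <= k)%N -> (i < (u j).2)%N ->
    (u k).1 y i <-> (u j).1 y i.
  move=> Dy + ij => /subnK <-; elim: (k - j)%N => // l IHl; rewrite -IHl addSn.
  have [/(_ y Dy)/traceP tr _ _] := unext (l + j)%N; apply: tr.
  by rewrite (leq_trans ij)// umono// leq_addl.
(* Membership of [s] is settled by stage [s.+1], whose fixed length is at least [s.+1]. *)
pose X y := [set s : nat | (u s.+1).1 y s].
have XE k y i : D y -> (i < (u k).2)%N -> X y i <-> (u k).1 y i.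
  move=> Dy ik; have [ki|/ltnW ki] := leqP k i.+1.
    exact: (ustable k i.+1 y i Dy ki ik).
  exact: iff_sym (ustable i.+1 k y i Dy ki (ugt i.+1)).
exists X; split.
- by move=> s; have [_ /(_ s)] := uok s.+1.
- move=> y Dy; apply: (cvge_to_le (@phi_lsc (X y))).
  apply: nearW => k; apply: le_trans (Km _ ((uok k).1 y Dy)).
  apply: submeasure_le => // i [Xi /= ik].
  by apply/(XE k) => //; exact: leq_trans ik (ugt k).
move=> M mM MD Mbig; apply/eqyP => r r0.
apply: (@le_trans _ _ (Num.truncn r).+1%:R%:E).
  by rewrite lee_fin ltW// truncnS_gt.
(* Stage [k.+1] secures the value [k]; here [k] is [(Num.truncn r).+1], which exceeds [r]. *)
have [_ _ /(_ M mM MD Mbig)] := unext (Num.truncn r).+1.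
move=> /le_trans; apply; apply: submeasure_le => // i [[y My ui] /= ik].
by exists y => //; apply/(XE (Num.truncn r).+2) => //; exact: MD.
Qed.
End divisible_measure.

(** * Lebesgue measure on the unit interval and the equivalence with Egorov's property *)

Section lebesgue.
Variable R : realType.
Notation mu := (@completed_lebesgue_measure R).

Lemma borel_lebesgue_measurable (A : set R) :
  measurable (A : set (measurableTypeR R)) -> lebesgue_measurable A.
Proof. by move=> mA; exact: sub_caratheodory. Qed.

Lemma completed_lebesgue_measure_itv01 : mu `[0, 1] = 1%:E.
Proof.
rewrite (_ : mu _ = lebesgue_measure (`[0, 1] : set R))//.
by rewrite lebesgue_measure_itv/= lte_fin ltr01 oppr0 adde0.
Qed.

Lemma completed_lebesgue_measure_itv01_fin : (mu `[0%R, 1%R] < +oo)%E.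
Proof. by rewrite completed_lebesgue_measure_itv01 ltry. Qed.

(** The measure of the part of [E] left of [x] is a 1-Lipschitz function of [x], rising from 0 at 0
    to the measure of [E] at 1, so the intermediate value theorem applies. *)
Lemma divisible_lebesgue :
  divisible mu (`[0, 1] : set (lebesgueTypeR R)).
Proof.
move=> E mE E01 t t0 tE.
have mItv (i : interval R) : measurable ([set` i] : set (lebesgueTypeR R)).
  by apply: borel_lebesgue_measurable; exact: measurable_itv.
have Eoo A : A `<=` E -> measurable (A : set (lebesgueTypeR R)) ->
    mu A \is a fin_num.
  move=> AE mA; rewrite ge0_fin_numE// (@le_lt_trans _ _ (mu `[0, 1]))//.
    by apply: le_measure; rewrite ?inE//; exact: subset_trans E01.
  by rewrite completed_lebesgue_measure_itv01 ltry.
pose A x := E `&` `]-oo, x].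
have mA x : measurable (A x : set (lebesgueTypeR R)) by exact: measurableI.
have finA x : mu (A x) \is a fin_num by apply: Eoo => // y [].
pose G x := fine (mu (A x)).
have Gmono x y : x <= y -> G x <= G y /\ G y - G x <= y - x.
  move=> xy.
  have AU : A y = A x `|` (E `&` `]x, y]).
    rewrite -setIUr; congr (_ `&` _); apply/seteqP; split=> z /=.
      by rewrite !in_itv/= => zy; have [zx|xz] := leP z x; [left|right].
    by rewrite !in_itv/= => -[zx|/andP[]//]; exact: le_trans xy.
  have mE' : measurable (E `&` `]x, y] : set (lebesgueTypeR R)) by exact: measurableI.
  have muA : mu (A y) = (mu (A x) + mu (E `&` `]x, y]))%E.
    rewrite AU; apply: measureU => //.
    apply/seteqP; split=> // z [[_ /=]]; rewrite !in_itv/= => zx [_ /andP[xz _]].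
    by rewrite ltNge zx in xz.
  have finE' : mu (E `&` `]x, y]) \is a fin_num by apply: Eoo => // z [].
  have -> : G y = G x + fine (mu (E `&` `]x, y])).
    by rewrite /G muA fineD.
  rewrite lerDl fine_ge0 ?measure_ge0//; split=> //.
  rewrite addrAC subrr add0r -lee_fin fineK//.
  apply: (@le_trans _ _ (mu `]x, y])).
    by apply: le_measure; rewrite ?inE// => z [].
  rewrite (_ : mu _ = lebesgue_measure (`]x, y] : set R))// lebesgue_measure_itv/=.
  by case: ifP => // _; rewrite lee_fin subr_ge0.
have Glip x y : `|G x - G y| <= `|x - y|.
  wlog xy : x y / x <= y.
    by move=> H; have [/H//|/ltW/H] := leP x y; rewrite distrC (distrC x).
  have [Gxy GL] := Gmono x y xy.
  by rewrite distrC (distrC x) !ger0_norm// subr_ge0.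
have Gcont : continuous G.
  move=> x; apply/cvgrPdist_lt => e e0; near=> y.
  apply: le_lt_trans (Glip x y) _; near: y.
  exact: (@nbhsx_ballx _ _ x e e0).
have G0 : G 0 = 0.
  apply/eqP; rewrite eq_le fine_ge0 ?measure_ge0// andbT -lee_fin fineK//.
  apply: (@le_trans _ _ (mu `[0, 0])).
    apply: le_measure; rewrite ?inE// => z [/E01/=].
    by rewrite !in_itv/= => /andP[-> _].
  rewrite (_ : mu _ = lebesgue_measure (`[0, 0] : set R))// lebesgue_measure_itv/=.
  by rewrite ltxx.
have A1 : A 1 = E.
  apply/seteqP; split=> z; first by case.
  by move=> Ez; split=> //; have /= := E01 z Ez; rewrite !in_itv/= => /andP[].
have G1 : t <= G 1.
  by rewrite -lee_fin fineK// A1.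
have [||c _ Gc] := @IVT R G 0 1 t ler01.
- exact: continuous_subspaceT.
- by rewrite G0 min_l ?max_r ?t0//; exact: le_trans G1.
by exists (A c); split=> //; [move=> z []|rewrite -Gc fineK].
Unshelve. all: by end_near. Qed.

Lemma countably_generated_Egorov (S : countType) (I : set (set S)) :
  is_ideal I -> countably_generated I -> Egorov R I.
Proof.
move=> hI /(countably_generated_exhaustion hI)[A [IA mono cofA]].
move=> f_ f mf_ mf cvg eta eta0.
have [|||M [M01 mM smallM unif]] := @almost_uniform_exhaustion _ (lebesgueTypeR R) R
   mu S A `[0, 1] f_ f eta _ _ mono mf_ mf _ eta0.
- by apply: borel_lebesgue_measurable; exact: measurable_itv.
- exact: completed_lebesgue_measure_itv01_fin.
- by move=> y y01 e e0; apply: cofA; exact: cvg.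
exists M; split=> // e /unif[n Mn].
exact: ideal_sub Mn (IA n).
Qed.

Lemma Egorov_countably_generated (I : set (set nat)) :
  nonpathological_ideal R I -> Egorov R I -> countably_generated I.
Proof.
move=> [phi [phi_sub phi_lsc phi_np ->]] egorov; apply: contrapT => ncg.
have [m [K [K0 Km Kkernel]]] := submeasure_kernel phi_sub ncg.
have m01 : measurable (`[0, 1] : set (lebesgueTypeR R)).
  by apply: borel_lebesgue_measurable; exact: measurable_itv.
have [X [mX phiX bigX]] := kernel_limit m01
  completed_lebesgue_measure_itv01_fin divisible_lebesgue phi_sub phi_np Kkernel
  phi_lsc K0 Km.
pose f_ (s : nat) : R -> R := \1_(`[0, 1] `&` [set y | X y s]).
have fE s y (e : R) : 0 < e -> e <= `|f_ s y - 0| -> X y s.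
  move=> e0; rewrite /f_ indicE subr0; case: (asboolP (X y s)) => // nX.
  by rewrite memNset ?normr0 1?leNgt ?e0// => -[].
(* Pointwise convergence to 0 holds because the exceptional indices at [y] lie in [X y], where [phi]
   is at most [m]. The choice [1 / 2] leaves [M] with more than half of the measure. *)
have [||| |M [M01 mM smallM unif]] := egorov f_ (fun=> 0) _ _ _ (1 / 2).
- by move=> s; apply: measurable_indic; exact: mX.
- exact: measurable_cst.
- move=> y y01 e e0; rewrite /Fin_of /=; apply: le_lt_trans (ltry m%:R).
  apply: le_trans (phiX y y01); apply: submeasure_le => // s /=.
  exact: fE.
- by rewrite divr_gt0.
have muM : (mu `[0%R, 1%R] < mu M + mu M)%E.
  have mMc : measurable (`[0, 1] `\` M : set (lebesgueTypeR R)) by exact: measurableD.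
  have : mu `[0%R, 1%R] = (mu M + mu (`[0%R, 1%R] `\` M))%E.
    by rewrite -measureU ?setDIK//= setDUK.
  rewrite completed_lebesgue_measure_itv01 => mu1.
  have finM : mu M \is a fin_num.
    rewrite ge0_fin_numE// (le_lt_trans _ completed_lebesgue_measure_itv01_fin)//.
    by apply: le_measure; rewrite ?inE.
  have finMc : mu (`[0, 1] `\` M) \is a fin_num.
    by rewrite ge0_fin_numE// (lt_trans smallM)// ltry.
  move: mu1 smallM; rewrite -(fineK finM) -(fineK finMc).
  move: (fine (mu M)) (fine (mu _)) => a b; rewrite -!EFinD lte_fin lte_fin => -[].
  lra.
(* At threshold 1 the exceptional indices over [M] are exactly the union of the [X y], on which
   [phi] is infinite. *)
have := unif 1 ltr01; rewrite /Fin_of /= ltNge => /negP; apply.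
rewrite leye_eq; apply/eqP; rewrite -[RHS](bigX M mM M01 muM).
congr phi; apply/seteqP; split=> s.
  by move=> [y My /fE Xys]; exists y => //; exact: Xys.
move=> [y My Xys]; exists y => //.
by rewrite /f_ indicE subr0 mem_set ?normr1//; split=> //; exact: M01.
Qed.
End lebesgue.

Theorem theorem4p4 (R : realType) (I : set (set nat)) (hI : is_ideal I)
    (hS : Sigma02 I) (hnp : nonpathological_ideal R I) :
  (Egorov R I <-> countably_generated I) /\
  (countably_generated I <->
    ideal_isomorphic I Fin \/ ideal_isomorphic I Fin_oplus_P \/
    ideal_isomorphic I Fin_otimes_empty).
Proof.
split; last exact: countably_generated_classification.
split; first exact: Egorov_countably_generated.
exact: countably_generated_Egorov.
Qed.
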